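(* For every $s\in\mathbb{N}$, we have $$\operatorname{bp}(K_{1,s})=\begin{cases}0 & \text{for } s\le 6,\\ t'(s,5) & \text{for } s>6,\end{cases}$$ where $t'(s,5)=5\cdot\binom{\lfloor s/5\rfloor}{2}+\left\lfloor\frac{s}{5}\right\rfloor (s \bmod 5)=\frac{1}{10}s^2+O(s)$.
   Context: $K_{1,s}$ is the star with $s$ leaves. A planar drawing $\Gamma$ of a graph is a straight-line drawing in the plane (distinct vertices at distinct points, edges drawn as segments) in which no two edges intersect in a point that is interior to at least one of them. $d_\Gamma(u,v)$ is the Euclidean distance between the points of $u$ and $v$. For a planar drawing $\Gamma$ of a tree $T$, a pair of non-adjacent vertices $u,v$ is a bad pair if there is an edge $wz$ on the path from $u$ to $v$ in $T$ with $d_\Gamma(u,v)<d_\Gamma(w,z)$. $\operatorname{bp}(T)$ is the smallest number of bad pairs over all planar drawings of $T$. $t'(n,r)$ denotes the minimum number of edges in a graph on $n$ vertices such that every induced subgraph on $r+1$ vertices has at least one edge. *)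

(* Defs.v *)
From HB Require Import structures.
From mathcomp Require Import all_boot all_order all_algebra.
From mathcomp Require Import all_classical all_reals all_analysis.

Set Implicit Arguments.
Unset Strict Implicit.
Unset Printing Implicit Defensive.

Import Order.TTheory GRing.Theory Num.Theory.

Local Open Scope ring_scope.

Definition is_least (A : set nat) (n : nat) : Prop :=
  A n /\ forall m, A m -> (n <= m)%N.

(* The smallest element of [A]; the value 0 is a dummy when [A] is empty
   (see [nat_minP], [graph_for_tprime] and [star_drawable]). *)
Definition nat_min (A : set nat) : nat := xget 0%N [set n | is_least A n].

Lemma nat_minP (A : set nat) : (exists n, A n) -> is_least A (nat_min A).
Proof.
case=> n An; rewrite /nat_min; apply: (@xgetPex _ 0%N [set k | is_least A k]).
have ex : exists k, `[< A k >] by exists n; apply/asboolP.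
exists (ex_minn ex); case: ex_minnP => k /asboolP Ak leA; split=> // m Am.
by apply: leA; apply/asboolP.
Qed.

Record sgraph (V : finType) := SGraph {
  adj :> rel V;
  adj_sym : symmetric adj;
  adj_irr : irreflexive adj }.

Definition edges (V : finType) (G : sgraph V) : {set {set V}} :=
  [set e | [exists u, exists v, G u v && (e == [set u; v])]].

Definition induced_edges (V : finType) (G : sgraph V) (A : {set V}) :
  {set {set V}} := [set e in edges G | e \subset A].

(* [tprime n r] is meaningful for [0 < r]. *)
Definition tprime (n r : nat) : nat :=
  nat_min [set k | exists G : sgraph 'I_n,
    (forall A : {set 'I_n}, #|A| = r.+1 -> (0 < #|induced_edges G A|)%N) /\
    k = #|edges G|].

Lemma graph_for_tprime (n r : nat) : (0 < r)%N ->
  exists G : sgraph 'I_n,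
    forall A : {set 'I_n}, #|A| = r.+1 -> (0 < #|induced_edges G A|)%N.
Proof.
move=> r0; unshelve eexists; first exists (fun i j : 'I_n => i != j).
- by move=> i j; rewrite eq_sym.
- by move=> i; rewrite eqxx.
move=> A cA; have : (1 < #|A|)%N by rewrite cA.
case/card_gt1P => x [y [xA yA xy]]; apply/card_gt0P; exists [set x; y].
rewrite !inE; apply/andP; split.
  by apply/existsP; exists x; apply/existsP; exists y; rewrite /= xy eqxx.
by apply/fintype.subsetP => z; rewrite !inE => /orP[]/eqP->.
Qed.

(* In the sense of [cycle], an edge traversed back and forth is a cycle of
   size 2; the cycles of a simple graph are those of size at least 3. *)
Definition is_tree (V : finType) (G : sgraph V) : Prop :=
  [/\ (0 < #|V|)%N,
      (forall u v : V, connect G u v) &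
      (forall c : seq V, ucycle G c -> (size c <= 2)%N)].

Record tree := Tree {
  tvert : finType;
  tgraph :> sgraph tvert;
  tgraph_is_tree : is_tree tgraph }.

(* [u :: p] is a path without repeated vertices from [u] to [v]; in a tree
   there is exactly one such [p]. *)
Definition simple_path (V : finType) (G : sgraph V) (u v : V) (p : seq V) :
  bool := [&& path G u p, last u p == v & uniq (u :: p)].

(* The canonical norm on ['rV[R]_2] is the sup norm, hence the explicit
   Euclidean distance. *)
Definition dist (R : realType) (a b : 'rV[R]_2) : R :=
  Num.sqrt (\sum_(i < 2) (a ord0 i - b ord0 i) ^+ 2).

Definition segment (R : realType) (a b : 'rV[R]_2) : set 'rV[R]_2 :=
  [set p | exists t : R, 0 <= t <= 1 /\ p = (1 - t) *: a + t *: b].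

Definition open_segment (R : realType) (a b : 'rV[R]_2) : set 'rV[R]_2 :=
  [set p | exists t : R, 0 < t < 1 /\ p = (1 - t) *: a + t *: b].

Definition planar_drawing (R : realType) (V : finType) (G : sgraph V)
    (D : V -> 'rV[R]_2) : Prop :=
  injective D /\
  forall u v w z : V, G u v -> G w z -> [set u; v] <> [set w; z] ->
    forall p : 'rV[R]_2,
      ~ (open_segment (D u) (D v) p /\ segment (D w) (D z) p).

Definition bad_pair (R : realType) (T : tree) (D : tvert T -> 'rV[R]_2)
    (u v : tvert T) : Prop :=
  [/\ u != v, ~~ T u v &
      exists p : seq (tvert T), exists w z : tvert T,
        [/\ simple_path T u v p, infix [:: w; z] (u :: p) &
            dist (D u) (D v) < dist (D w) (D z)]].

Definition num_bad_pairs (R : realType) (T : tree)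
    (D : tvert T -> 'rV[R]_2) : nat :=
  #|[set e : {set tvert T} |
      `[< exists u v, e = [set u; v] /\ bad_pair D u v >]]|.

Definition bp (R : realType) (T : tree) : nat :=
  nat_min [set k | exists D : tvert T -> 'rV[R]_2,
    planar_drawing T D /\ k = num_bad_pairs D].

(* The centre of the star is [None]. *)
Definition star_adj (s : nat) : rel (option 'I_s) :=
  fun u v => isSome u (+) isSome v.

Lemma star_adj_sym (s : nat) : symmetric (@star_adj s).
Proof. by move=> u v; rewrite /star_adj addbC. Qed.

Lemma star_adj_irr (s : nat) : irreflexive (@star_adj s).
Proof. by move=> u; rewrite /star_adj addbb. Qed.

Definition star_graph (s : nat) : sgraph (option 'I_s) :=
  SGraph (@star_adj_sym s) (@star_adj_irr s).

Lemma star_is_tree (s : nat) : is_tree (star_graph s).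
Proof.
split; first by rewrite card_option.
- have c0 u : connect (star_graph s) None u.
    by case: u => [i|]; [apply: connect1 | apply: connect0].
  have cs : connect_sym (star_graph s).
    by apply: sym_connect_sym; exact: star_adj_sym.
  by move=> u v; apply: (connect_trans _ (c0 v)); rewrite cs.
- case=> [|x [|y [|z c]]] //; rewrite /ucycle /=.
  case: x => [i|]; case: y => [j|]; case: z => [k|] //;
  case: c => [|[l|] c] //=; rewrite /star_adj /= ?inE ?eqxx ?orbT ?andbF //.
Qed.

Definition star (s : nat) : tree := Tree (star_is_tree s).

Lemma star_drawable (R : realType) (s : nat) :
  exists D : tvert (star s) -> 'rV[R]_2, planar_drawing (star s) D.
Proof.
pose D (u : option 'I_s) : 'rV[R]_2 := \row_j
  (if u is Some i then (if j == ord0 then (i : nat)%:R else 1) else 0).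
have D0 u : D u ord0 ord0 = if u is Some i then (i : nat)%:R else 0.
  by rewrite mxE; case: u.
have D1 u : D u ord0 ord_max = (isSome u)%:R.
  by rewrite mxE; case: u.
exists D; split.
  move=> u v uv; have := congr1 (fun M : 'rV_2 => M ord0 ord0) uv.
  have := congr1 (fun M : 'rV_2 => M ord0 ord_max) uv.
  rewrite /= !D0 !D1; case: u {uv} => [i|]; case: v => [j|] //= /eqP.
  - by move=> _ /eqP; rewrite eqr_nat => /eqP/val_inj->.
  - by rewrite oner_eq0.
  - by rewrite eq_sym oner_eq0.
have key i j (a b : R) : 0 < a -> a *: D (Some i) = b *: D (Some j) -> i = j.
  move=> a0 ab; have := congr1 (fun M : 'rV_2 => M ord0 ord0) ab.
  have := congr1 (fun M : 'rV_2 => M ord0 ord_max) ab.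
  rewrite !mxE /= !mulr1 => <- /mulfI.
  by move=> /(_ (lt0r_neq0 a0))/eqP; rewrite eqr_nat => /eqP/val_inj.
have DN : D None = 0 by apply/matrixP => i j; rewrite !mxE.
move=> u v w z uv wz ne p [[t [/andP[t0 t1] pE]] [t' [_ pE']]].
move: pE; rewrite {}pE'; have t1' : 0 < 1 - t by rewrite subr_gt0.
case: u uv ne => [i|]; case: v => [j|] //; case: w wz => [k|];
  case: z => [l|] //= _ _ ne; rewrite DN !scaler0 ?addr0 ?add0r => /esym;
  [move/(key _ _ _ _ t1')|move/(key _ _ _ _ t1')
  |move/(key _ _ _ _ t0)|move/(key _ _ _ _ t0)] => E; apply: ne;
  by rewrite E // finset.setUC.
Qed.

(* Main.v *)
(* Two leaves of a star are a bad pair iff one of their edges to the centre is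
   longer than their distance, so leaves seen from the centre at an angle below
   pi/3 always form a bad pair.  If six leaves are pairwise good and [v] is a
   seventh leaf, the six half-open sectors of angle pi/3 starting at [v]
   counterclockwise contain one of the six leaves each, so one of them is bad
   with [v]; the same holds clockwise, which gives a second one.  Now remove a
   maximal set of pairwise good leaves: if it has at most five elements, every
   other leaf is bad with at least one of them (Turan's induction); if it has
   six, with at least two.  Both steps cost at least the increment of the Turan
   number, except for [s = 6].  For the upper bound, the leaves are put into five
   balanced clusters near the vertices of an almost regular pentagon. *)
Require Import Defs.
From mathcomp Require Import all_boot all_order all_algebra.
From mathcomp Require Import all_classical all_reals all_analysis.
From mathcomp Require Import zify ring lra.

Import Order.TTheory GRing.Theory Num.Theory.
Import numFieldNormedType.Exports.

(** * Arithmetic of the Turan numbers *)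

(** Edge number of [r] disjoint cliques of balanced sizes on [n] vertices: vertex [j] joins the
    [j %/ r] earlier vertices of its residue class. *)
Definition turan_co (r n : nat) : nat := \sum_(j < n) j %/ r.

Lemma turan_coS (r n : nat) : turan_co r n.+1 = turan_co r n + n %/ r.
Proof. by rewrite /turan_co big_ord_recr. Qed.

(** One new vertex in each of the [r] cliques: together they meet every old vertex exactly once. *)
Lemma turan_co_addr (r n : nat) : 0 < r ->
  turan_co r (n + r) = turan_co r n + n.
Proof.
move=> r0; elim: n => [|n IH].
  by rewrite /turan_co big_ord0 big1 // => j _; rewrite divn_small.
by rewrite addSn !turan_coS IH divnDr ?dvdnn // divnn r0; lia.
Qed.

Lemma turan_co_le (r m n : nat) : m <= n -> turan_co r m <= turan_co r n.
Proof.
move=> /subnK <-; elim: (n - m) => // k IH.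
by rewrite addSn turan_coS (leq_trans IH) ?leq_addr.
Qed.

Lemma turan_co5E (n : nat) :
  turan_co 5 n = 5 * 'C(n %/ 5, 2) + (n %/ 5) * (n %% 5).
Proof.
rewrite {1}(divn_eq n 5); have := ltn_pmod n (isT : 0 < 5).
move: (n %% 5) (n %/ 5) => r q r5.
(* The terms of the sum with index [q * 5 + k], [k < 5], all equal [q]. *)
have step k : k <= 5 -> turan_co 5 (q * 5 + k) = turan_co 5 (q * 5) + q * k.
  elim: k => [|k IH] k5; first by rewrite addn0; lia.
  by rewrite addnS turan_coS IH; last lia; rewrite divnMDl // divn_small; lia.
rewrite step; last by lia.
congr (_ + _); elim: q {step} => [|q IH]; first by rewrite /turan_co big_ord0.
by rewrite mulSn addnC turan_co_addr // IH binS bin1; lia.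
Qed.

(** * Stable sets and lower bounds for edge numbers *)

Definition stable {V : finType} (G : sgraph V) (I : {set V}) : bool :=
  [forall u in I, forall v in I, ~~ G u v].

Lemma stableP {V : finType} (G : sgraph V) (I : {set V}) :
  reflect {in I &, forall u v, ~~ G u v} (stable G I).
Proof.
apply: (iffP forall_inP) => [H u v uI vI|H u uI].
  by have /forall_inP := H u uI; apply.
by apply/forall_inP => v vI; apply: H.
Qed.

Lemma stable_sub {V : finType} (G : sgraph V) (I J : {set V}) :
  I \subset J -> stable G J -> stable G I.
Proof.
move=> /fintype.subsetP IJ /stableP J0; apply/stableP => u v uI vI.
by apply: J0; apply: IJ.
Qed.

Lemma edge_in {V : finType} (G : sgraph V) (A : {set V}) (u v : V) :
  G u v -> u \in A -> v \in A -> [set u; v] \in induced_edges G A.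
Proof.
move=> uv uA vA; rewrite !inE; apply/andP; split.
  by apply/existsP; exists u; apply/existsP; exists v; rewrite uv eqxx.
by apply/fintype.subsetP => x; rewrite !inE => /orP[]/eqP->.
Qed.

Lemma induced_edges_setT {V : finType} (G : sgraph V) :
  induced_edges G [set: V] = edges G.
Proof. by apply/setP => e; rewrite !inE finset.subsetT andbT. Qed.

Lemma stable_induced {V : finType} (G : sgraph V) (I : {set V}) :
  stable G I -> #|induced_edges G I| = 0.
Proof.
move/stableP => I0; apply/eqP; rewrite cards_eq0; apply/eqP/setP => e.
rewrite !inE; apply/negbTE/negP => /andP[/existsP[u /existsP[v /andP[uv /eqP->]]]].
move=> /fintype.subsetP sI.
by have := I0 u v (sI u (set21 u v)) (sI v (set22 u v)); rewrite uv.
Qed.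

Lemma exists_subset_card {V : finType} (A : {set V}) (k : nat) :
  k <= #|A| -> exists2 B : {set V}, B \subset A & #|B| = k.
Proof.
move=> kA; exists [set x in take k (enum A)].
  by apply/fintype.subsetP => x; rewrite inE => /mem_take; rewrite mem_enum.
rewrite cardsE (card_uniqP _) ?take_uniq ?enum_uniq //.
by rewrite size_takel // -cardE.
Qed.

(** Pairs from [A :\: I] to [I] give distinct edges, since exactly one end lies in [I]; for the same
    reason none of them is an edge inside [A :\: I]. *)
Lemma leq_induced_edges {V : finType} (G : sgraph V) (A I : {set V}) (m : nat) :
  I \subset A ->
  (forall v, v \in A :\: I -> m <= #|[set i in I | G v i]|) ->
  m * #|A :\: I| + #|induced_edges G (A :\: I)| <= #|induced_edges G A|.
Proof.
move=> IA deg.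
pose S := [set p : V * V | (p.1 \in A :\: I) && (p.2 \in [set i in I | G p.1 i])].
have cS : m * #|A :\: I| <= #|S|.
  rewrite mulnC -sum_nat_const -sum1_card.
  rewrite (eq_bigl (fun p : V * V => (p.1 \in A :\: I) &&
     (p.2 \in [set i in I | G p.1 i]))); last by move=> p; rewrite [LHS]inE.
  rewrite -(pair_big_dep (fun v => v \in A :\: I)
     (fun v i => i \in [set i in I | G v i]) (fun _ _ => 1)) /=.
  by apply: leq_sum => v vA; rewrite sum1_card deg.
pose f (p : V * V) := [set p.1; p.2].
have finj : {in S &, injective f}.
  move=> [v i] [w j]; rewrite !inE /= => /andP[/andP[vI vA] /andP[iI vi]].
  move=> /andP[/andP[wI wA] /andP[jI wj]].
  rewrite /f /= => /setP E.
  have := E v; rewrite !inE eqxx /= => /esym/orP[/eqP vw|/eqP vj]; last first.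
    by rewrite vj jI in vI.
  have := E i; rewrite !inE eqxx orbT => /esym/orP[/eqP iw|/eqP ->].
    by rewrite -iw iI in wI.
  by rewrite vw.
rewrite -(card_in_imset finj) in cS.
apply: (leq_trans (leq_add cS (leqnn _))); rewrite -cardsUI.
have -> : [set f x | x in S] :&: induced_edges G (A :\: I) = finset.set0.
  apply/setP => e; rewrite inE [RHS]inE; apply/negbTE/negP => /andP[/imsetP[[v i]]].
  rewrite !inE /= => /andP[_ /andP[iI _]] -> /andP[_ /fintype.subsetP/(_ i)].
  by rewrite !inE eqxx orbT iI => /(_ isT).
rewrite cards0 addn0.
apply/subset_leq_card/fintype.subsetP => e; rewrite inE => /orP[].
  move=> /imsetP[[v i]]; rewrite !inE /= => /andP[/andP[vI vA] /andP[iI vi]] ->.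
  by have := edge_in G A v i vi vA (fintype.subsetP IA i iI); rewrite !inE.
rewrite !inE => /andP[-> sub]; exact: (fintype.subset_trans sub (finset.subsetDl _ _)).
Qed.

(** A maximal stable set [I] of [A] is removed: it has at most [r] elements, and by maximality every
    vertex of [A :\: I] has a neighbour in it. *)
Lemma turan_lower {V : finType} (G : sgraph V) (r : nat) (A : {set V}) : 0 < r ->
  (forall I : {set V}, I \subset A -> #|I| = r.+1 -> ~~ stable G I) ->
  turan_co r #|A| <= #|induced_edges G A|.
Proof.
move=> r0; have [n] := ubnP #|A|; elim: n A => // n IH A An noI.
have [->|A0] := eqVneq A finset.set0.
  by rewrite cards0 /turan_co big_ord0.
pose P (I : {set V}) := (I \subset A) && stable G I.
have P0 : P finset.set0.
  by rewrite /P finset.sub0set; apply/stableP => u v; rewrite inE.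
have [I /maxsetP[/andP[IA I0] Imax] _] := maxset_exists P0.
have nbr v : v \in A :\: I -> 1 <= #|[set i in I | G v i]|.
  rewrite inE => /andP[vI vA]; rewrite lt0n cards_eq0; apply: contraNneq vI => N0.
  have nv i : i \in I -> ~~ G v i.
    by move=> iI; have /setP/(_ i) := N0; rewrite !inE iI /= => ->.
  rewrite -(Imax (v |: I)) ?setU11 ?finset.subsetUr //.
  rewrite /P finset.subUset finset.sub1set vA IA; apply/stableP => x y; rewrite !inE.
  move=> /orP[/eqP->|xI] /orP[/eqP->|yI]; rewrite ?adj_irr ?nv //.
    by rewrite adj_sym nv.
  by move/stableP: I0; apply.
have Ir : #|I| <= r.
  rewrite leqNgt; apply/negP => /exists_subset_card[J JI cJ].
  by have := noI J (fintype.subset_trans JI IA) cJ; rewrite (stable_sub _ _ _ JI I0).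
(* This makes the induction decrease: with [I] empty, a vertex of [A] would need a neighbour in the
   empty set. *)
have I_gt0 : 0 < #|I|.
  rewrite lt0n cards_eq0; apply: contraNneq A0 => E; apply/eqP/setP => v.
  rewrite inE; apply/negbTE/negP => vA; have := nbr v.
  by rewrite E !inE vA => /(_ isT)/card_gt0P[i]; rewrite !inE.
have cA : #|A| = #|A :\: I| + #|I| by rewrite -(cardsID I A) (finset.setIidPr IA) addnC.
apply: leq_trans (leq_induced_edges G A I 1 IA nbr).
(* [I] may have fewer than [r] vertices; monotonicity rounds its size up to [r]. *)
rewrite mul1n addnC (leq_trans (turan_co_le r _ (#|A :\: I| + r) _)) //.
  by rewrite cA leq_add2l.
rewrite turan_co_addr // leq_add2r IH //.
  by move: An; rewrite cA; lia.
move=> J JA; apply: noI; exact: (fintype.subset_trans JA (finset.subsetDl _ _)).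
Qed.

(* A stable set of size 6 cannot be excluded: the leaves may form a regular hexagon. *)
Lemma turan_lower_hexagon {V : finType} (G : sgraph V) (A : {set V}) :
  (forall (I : {set V}) v, #|I| = 6 -> stable G I -> v \notin I ->
     1 < #|[set i in I | G v i]|) ->
  turan_co 5 #|A| <= #|induced_edges G A| + (#|A| == 6).
Proof.
move=> hex; have [n] := ubnP #|A|; elim: n A => // n IH A An.
have [/existsP[I /and3P[IA /eqP cI I0]]|noI] :=
  boolP [exists I : {set V}, [&& I \subset A, #|I| == 6 & stable G I]]; last first.
  rewrite (leq_trans _ (leq_addr _ _)) // turan_lower // => I IA cI.
  by apply: contra noI => I0; apply/existsP; exists I; rewrite IA cI eqxx I0.
have cA : #|A| = #|A :\: I| + 6 by rewrite -cI -(cardsID I A) (finset.setIidPr IA) addnC.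
have le : 2 * #|A :\: I| + #|induced_edges G (A :\: I)| <= #|induced_edges G A|.
  apply: leq_induced_edges => // v; rewrite inE => /andP[vI _]; exact: hex.
(* With m vertices left, the Turan number grows by m + floor(m/5) + 1, against 2m edges. Only m = 0
   falls short, by 1, which [#|A| == 6] covers; m = 6 has enough to spare for the extra 1 in the
   induction hypothesis. *)
have := IH (A :\: I); rewrite cA addnS turan_coS turan_co_addr // divnDr //.
by move: An le; rewrite cA; lia.
Qed.

(** * The extremal graph and the value of [tprime] *)

(** The complement of the Turan graph, with the residue classes mod [r] as cliques. *)
Definition mod_adj (r n : nat) : rel 'I_n :=
  fun i j => (i != j) && (i == j %[mod r]).

Lemma mod_adj_sym (r n : nat) : symmetric (mod_adj r n).
Proof. by move=> i j; rewrite /mod_adj; congr andb; rewrite eq_sym. Qed.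

Lemma mod_adj_irr (r n : nat) : irreflexive (mod_adj r n).
Proof. by move=> i; rewrite /mod_adj eqxx. Qed.

Definition mod_graph (r n : nat) : sgraph 'I_n :=
  SGraph (mod_adj_sym r n) (mod_adj_irr r n).

(** Each edge is counted at its larger end [j]; the smaller ends in the class of [j] have distinct
    quotients by [r], all below [j %/ r]. *)
Lemma card_edges_mod_graph (r n : nat) : 0 < r ->
  #|edges (mod_graph r n)| <= turan_co r n.
Proof.
move=> r0; pose S := [set p : 'I_n * 'I_n | (p.2 < p.1) && (p.2 == p.1 %[mod r])].
have sub : edges (mod_graph r n) \subset [set [set p.1; p.2] | p in S].
  apply/fintype.subsetP => e; rewrite inE.
  move=> /existsP[i /existsP[j /andP[/andP[ij ijr] /eqP->]]].
  case: (ltngtP i j) => [lt|lt|/val_inj E]; last by rewrite E eqxx in ij.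
    by apply/imsetP; exists (j, i); rewrite ?inE ?lt //= finset.setUC.
  by apply/imsetP; exists (i, j); rewrite ?inE ?lt //= eq_sym.
apply: (leq_trans (subset_leq_card sub)); apply: (leq_trans (leq_imset_card _ _)).
rewrite -sum1_card (eq_bigl (fun p : 'I_n * 'I_n => true &&
  ((p.2 < p.1) && (p.2 == p.1 %[mod r])))); last by move=> p; rewrite inE.
rewrite -(pair_big_dep xpredT
  (fun j i : 'I_n => (i < j) && (i == j %[mod r])) (fun _ _ => 1)) /=.
apply: leq_sum => j _; rewrite sum1dep_card.
have [q0|q0] := posnP (j %/ r).
  rewrite q0 leqn0 cards_eq0; apply/eqP/setP => i; rewrite !inE.
  apply/negbTE/negP => /andP[ij /eqP E].
  by move: ij; rewrite (divn_eq i r) (divn_eq j r) E q0 ltn_add2r ltnNge leq0n.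
(* [inord] needs a successor as bound; [j %/ r] is positive here. *)
pose f (i : 'I_n) : 'I_(j %/ r).-1.+1 := inord (i %/ r).
have lt i : (i < j) && (i == j %[mod r]) -> i %/ r < (j %/ r).-1.+1.
  rewrite prednK // => /andP[ij /eqP E].
  by move: ij; rewrite {1}(divn_eq i r) {1}(divn_eq j r) E ltn_add2r ltn_mul2r r0.
have finj : {in [set i : 'I_n | (i < j) && (i == j %[mod r])] &, injective f}.
  move=> i k; rewrite !inE => Hi Hk /(congr1 val) /=.
  rewrite !inordK ?lt // => E; apply/val_inj => /=.
  by rewrite (divn_eq i r) (divn_eq k r) E; case/andP: Hi Hk => _ /eqP-> /andP[_ /eqP->].
rewrite -(card_in_imset finj) (leq_trans (max_card _)) // card_ord prednK //.
Qed.

Lemma mod_graph_edge (r n : nat) (A : {set 'I_n}) : 0 < r ->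
  #|A| = r.+1 -> 0 < #|induced_edges (mod_graph r n) A|.
Proof.
case: r => // r _ cA; pose f (i : 'I_n) : 'I_r.+1 := inord (i %% r.+1).
have /dinjectivePn[i iA [j /andP[ji jA] ij]] : ~~ dinjectiveb f (mem A).
  apply/negP => /dinjectiveP/card_in_imset E.
  by have := max_card (mem (f @: A)); rewrite E cA card_ord ltnn.
apply/card_gt0P; exists [set i; j]; apply: edge_in => //=.
move/(congr1 val): ij => /=; rewrite !inordK ?ltn_pmod // => E.
by rewrite /mod_adj eq_sym ji E eqxx.
Qed.

Lemma tprimeE (n r : nat) : 0 < r -> tprime n r = turan_co r n.
Proof.
move=> r0; have [] := @nat_minP [set k | exists G : sgraph 'I_n,
    (forall A : {set 'I_n}, #|A| = r.+1 -> (0 < #|induced_edges G A|)%N) /\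
    k = #|edges G|]%classic.
  have [G HG] := @graph_for_tprime n r r0; by exists #|edges G|, G.
rewrite -/(tprime n r) /= => -[G [HG ->]] least.
apply/eqP; rewrite eqn_leq; apply/andP; split.
  apply: (leq_trans (least #|edges (mod_graph r n)| _)).
    by exists (mod_graph r n); split=> // A; apply: mod_graph_edge.
  exact: card_edges_mod_graph.
rewrite -{1}(card_ord n) -cardsT -induced_edges_setT turan_lower // => I _ cI.
by apply/negP => /stable_induced E; have := HG I cI; rewrite E.
Qed.

(** * Plane geometry: six sectors of angle pi/3 *)

Section Geometry.
Local Open Scope ring_scope.
Context {R : realType}.
Implicit Types (x y p q : R) (a b v w : 'rV[R]_2).

(* The coordinates (x, y) refer to two unit vectors at angle pi/3; [hexB] is
   twice the inner product. *)
Definition hexN x y : R := x ^+ 2 + x * y + y ^+ 2.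
Definition hexB x y x' y' : R := 2 * x * x' + 2 * y * y' + x * y' + x' * y.
(** By [hexN (x - x') (y - y') = hexN x y + hexN x' y' - hexB x y x' y'], this means that the two
    points are closer to each other than one of them is to the origin. *)
Definition hex_close x y x' y' : bool :=
  (hexN x y < hexB x y x' y') || (hexN x' y' < hexB x y x' y').

(* The half-open cone spanned by the two unit vectors has angle less than pi/3. *)
Lemma cone_close p q p' q' : 0 < p -> 0 <= q -> 0 < p' -> 0 <= q' ->
  hex_close p q p' q'.
Proof.
move=> p0 q0 p0' q0'; apply/negPn/negP; rewrite negb_or -!leNgt => /andP[h1 h2].
have pp : 0 < p * p' by rewrite mulr_gt0.
have qq : 0 <= q * q' by rewrite mulr_ge0.
have pq : 0 <= p * q' by rewrite mulr_ge0 // ltW.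
have qp : 0 <= p' * q by rewrite mulr_ge0 // ltW.
have B0 : 0 <= hexB p q p' q' by rewrite /hexB; lra.
(* If neither norm were below [hexB], their product would be at least its square; the factorization
   below contradicts this. *)
have := ler_pM B0 B0 h1 h2; rewrite leNgt => /negP; apply.
rewrite -subr_gt0.
have -> : hexB p q p' q' * hexB p q p' q' - hexN p q * hexN p' q' =
  3 * (p * p' + q * q' + p * q') * (p * p' + q * q' + p' * q).
  by rewrite /hexB /hexN; ring.
by rewrite mulr_gt0 // ?mulr_gt0 //; lra.
Qed.

(** The six rotations of the first half-open cone, counterclockwise; the origin lands in the last
    branch by default. *)
Definition sector x y : 'I_6 :=
  if (0 < x) && (0 <= y) then inord 0 else
  if (x <= 0) && (0 < x + y) then inord 1 else
  if (0 < y) && (x + y <= 0) then inord 2 else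
  if (x < 0) && (y <= 0) then inord 3 else
  if (0 <= x) && (x + y < 0) then inord 4 else inord 5.

(** Rotation by pi/3 preserves [hexN] and [hexB], so every sector reduces to the cone of
    [cone_close]. *)
Lemma sector_close x y x' y' : (x != 0) || (y != 0) -> (x' != 0) || (y' != 0) ->
  sector x y = sector x' y' -> hex_close x y x' y'.
Proof.
have rot p q p' q' : 0 < p -> 0 <= q -> 0 < p' -> 0 <= q' ->
    hexN p q = hexN x y -> hexN p' q' = hexN x' y' ->
    hexB p q p' q' = hexB x y x' y' -> hex_close x y x' y'.
  by move=> h1 h2 h3 h4; rewrite /hex_close => <- <- <-; apply: cone_close.
have last_sector (u z : R) : (u != 0) || (z != 0) ->
    ~~ ((0 < u) && (0 <= z)) -> ~~ ((u <= 0) && (0 < u + z)) ->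
    ~~ ((0 < z) && (u + z <= 0)) -> ~~ ((u < 0) && (z <= 0)) ->
    ~~ ((0 <= u) && (u + z < 0)) -> (z < 0) && (0 <= u + z).
  case: (ltrgtP u 0) => u0; case: (ltrgtP z 0) => z0 //=;
  case: (ltrgtP (u + z) 0) => uz //=; lra.
move=> nz nz'; rewrite /sector.
case: (boolP (_ && _)) => h0;
  [|case: (boolP ((x <= 0) && _)) => h1;
  [|case: (boolP ((0 < y) && _)) => h2;
  [|case: (boolP ((x < 0) && _)) => h3;
  [|case: (boolP ((0 <= x) && _)) => h4]]]];
(case: (boolP ((0 < x') && _)) => h0';
  [|case: (boolP ((x' <= 0) && _)) => h1';
  [|case: (boolP ((0 < y') && _)) => h2';
  [|case: (boolP ((x' < 0) && _)) => h3';
  [|case: (boolP ((0 <= x') && _)) => h4']]]]);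
move=> /(congr1 val); rewrite /= !inordK // => _.
(* The witnesses turn sector k back by k steps of the clockwise rotation (x, y) -> (x + y, -x). *)
- by apply: (rot x y x' y'); rewrite /hexN /hexB; lra.
- by apply: (rot (x + y) (- x) (x' + y') (- x')); rewrite /hexN /hexB; try lra; ring.
- by apply: (rot y (- x - y) y' (- x' - y')); rewrite /hexN /hexB; try lra; ring.
- by apply: (rot (- x) (- y) (- x') (- y')); rewrite /hexN /hexB; try lra; ring.
- by apply: (rot (- x - y) x (- x' - y') x'); rewrite /hexN /hexB; try lra; ring.
- have := last_sector _ _ nz h0 h1 h2 h3 h4.
  have := last_sector _ _ nz' h0' h1' h2' h3' h4' => l l'.
  by apply: (rot (- y) (x + y) (- y') (x' + y')); rewrite /hexN /hexB; try lra; ring.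
Qed.

(** Pairwise far points lie in distinct sectors, so six of them fill all six. *)
Lemma six_sectors {T : finType} (I : {set T}) (x y : T -> R) : #|I| = 6%N ->
  {in I, forall i, (x i != 0) || (y i != 0)} ->
  {in I &, forall i j, i != j -> ~~ hex_close (x i) (y i) (x j) (y j)} ->
  exists2 i, i \in I & (0 < x i) && (0 <= y i).
Proof.
move=> cI nz far; pose f i := sector (x i) (y i).
have finj : {in I &, injective f}.
  move=> i j iI jI ij; apply/eqP; apply: contraT => ne.
  by have := far i j iI jI ne; rewrite sector_close ?nz.
have : f @: I = finset.setT.
  by apply/eqP; rewrite eqEcard finset.subsetT cardsT card_ord card_in_imset // cI.
move/setP/(_ (inord 0)); rewrite [RHS]inE => /imsetP[i iI /(congr1 val)].
rewrite /f /sector; case: ifP => [h|_] /=; first by exists i.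
by do 4?case: ifP => _; rewrite /= !inordK.
Qed.

Definition dot a b : R := a ord0 ord0 * b ord0 ord0 + a ord0 ord_max * b ord0 ord_max.

(** For leaves at [a] and [b] and the centre at 0, the first inequality says |a - b| < |b|, the
    second |a - b| < |a|. *)
Definition leaf_close a b : bool := (dot a a < 2 * dot a b) || (dot b b < 2 * dot a b).

Lemma dot_ge0 a : 0 <= dot a a.
Proof. by rewrite addr_ge0 // -expr2 sqr_ge0. Qed.

Lemma row2P a b : a ord0 ord0 = b ord0 ord0 -> a ord0 ord_max = b ord0 ord_max ->
  a = b.
Proof.
move=> h0 h1; apply/rowP => j; case: j => [[|[|//]] Hj].
  by rewrite (_ : Ordinal Hj = ord0) //; apply/val_inj.
by rewrite (_ : Ordinal Hj = ord_max) //; apply/val_inj.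
Qed.

Lemma dot_eq0 a : (dot a a == 0) = (a == 0).
Proof.
apply/eqP/eqP => [|->]; last by rewrite /dot !mxE mul0r addr0.
move/eqP; rewrite /dot -!expr2 paddr_eq0 ?sqr_ge0 // !sqrf_eq0 => /andP[/eqP h0 /eqP h1].
by apply: row2P; rewrite ?h0 ?h1 !mxE.
Qed.

Lemma dot_gt0 a : a != 0 -> 0 < dot a a.
Proof. by rewrite lt_def dot_ge0 andbT dot_eq0. Qed.

Lemma leaf_close_sym a b : leaf_close a b = leaf_close b a.
Proof. by rewrite /leaf_close orbC (_ : dot a b = dot b a) // /dot; ring. Qed.

Lemma leaf_close_parallel a b (k : R) : b != 0 -> 0 < k -> a = k *: b -> leaf_close a b.
Proof.
move=> /dot_gt0 b0 k0 ->; rewrite /leaf_close.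
have -> : dot (k *: b) b = k * dot b b by rewrite /dot !mxE; ring.
have -> : dot (k *: b) (k *: b) = k * (k * dot b b) by rewrite /dot !mxE; ring.
have kb : 0 < k * dot b b by rewrite mulr_gt0.
case: (ltrP k 2) => k2; apply/orP; [left|right].
  by rewrite ltr_pM2r.
have := ler_pM2r b0 2 k; rewrite k2; lra.
Qed.

Lemma leaf_close_two {T : finType} (I : {set T}) (w : T -> 'rV[R]_2) v : #|I| = 6%N ->
  v != 0 -> {in I, forall i, w i != 0} ->
  {in I &, forall i j, i != j -> ~~ leaf_close (w i) (w j)} ->
  {in I, forall i k, 0 < k -> w i <> k *: v} ->
  (1 < #|[set i in I | leaf_close v (w i)]|)%N.
Proof.
move=> cI v0 w0 far npar.
pose r3 : R := Num.sqrt 3.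
have r30 : 0 < r3 by rewrite sqrtr_gt0; lra.
have r3E : r3 ^+ 2 = 3 by rewrite sqr_sqrtr //; lra.
have V0 := dot_gt0 v v0.
pose det w := v ord0 ord0 * w ord0 ord_max - v ord0 ord_max * w ord0 ord0.
(* Coordinates of [w i] for the unit vectors at angles 0 and pi/3 from [v], scaled by sqrt 3 times
   the length of [v]; [v] itself becomes [(r3 * dot v v, 0)]. *)
pose x i := r3 * dot v (w i) - det (w i).
pose y i := 2 * det (w i).
have NE i : hexN (x i) (y i) = 3 * dot v v * dot (w i) (w i).
  rewrite /hexN /x /y; have -> : (r3 * dot v (w i) - det (w i)) ^+ 2 +
    (r3 * dot v (w i) - det (w i)) * (2 * det (w i)) + (2 * det (w i)) ^+ 2 =
    r3 ^+ 2 * dot v (w i) ^+ 2 + 3 * det (w i) ^+ 2 by ring.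
  by rewrite r3E /dot /det; ring.
have BE i j : hexB (x i) (y i) (x j) (y j) = 3 * dot v v * (2 * dot (w i) (w j)).
  have -> : hexB (x i) (y i) (x j) (y j) =
    2 * (r3 ^+ 2 * dot v (w i) * dot v (w j) + 3 * det (w i) * det (w j)).
    by rewrite /hexB /x /y; ring.
  by rewrite r3E /dot /det; ring.
have V3 : 0 < 3 * dot v v by lra.
have closeE i j : hex_close (x i) (y i) (x j) (y j) = leaf_close (w i) (w j).
  by rewrite /hex_close !NE BE !ltr_pM2l.
(* The map (u, z) -> (u + z, -z) is the reflection in the line of [v]. *)
have hexNm u z : hexN (u + z) (- z) = hexN u z by rewrite /hexN; ring.
have hexBm u z u' z' : hexB (u + z) (- z) (u' + z') (- z') = hexB u z u' z'.
  by rewrite /hexB; ring.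
have nz i : i \in I -> hexN (x i) (y i) != 0.
  move=> iI; rewrite NE mulf_neq0 ?lt0r_neq0 //; apply: dot_gt0; exact: w0.
have nz0 u z : hexN u z != 0 -> (u != 0) || (z != 0).
  apply: contraR; rewrite negb_or !negbK => /andP[/eqP-> /eqP->].
  by rewrite /hexN; apply/eqP; ring.
have [i iI /andP[xi yi]] : exists2 i, i \in I & (0 < x i) && (0 <= y i).
  apply: six_sectors => // [i iI|i j iI jI ij]; first by apply: nz0; apply: nz.
  by rewrite closeE far.
(* The same pigeonhole in the mirror image fixing [v]. *)
have [j jI /andP[xj yj]] : exists2 j, j \in I & (0 < x j + y j) && (0 <= - y j).
  apply: (six_sectors I (fun j => x j + y j) (fun j => - y j)) => // [j jI|j k jI kI jk].
    by apply: nz0; rewrite hexNm; apply: nz.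
  by rewrite /hex_close !hexNm hexBm -/(hex_close _ _ _ _) closeE far.
have vclose k : hex_close (r3 * dot v v) 0 (x k) (y k) = leaf_close v (w k).
  have -> : leaf_close v (w k) = (3 * dot v v * dot v v < 3 * dot v v * (2 * dot v (w k)))
     || (3 * dot v v * dot (w k) (w k) < 3 * dot v v * (2 * dot v (w k))).
    by rewrite !ltr_pM2l.
  rewrite -NE /hex_close.
  have -> : hexN (r3 * dot v v) 0 = r3 ^+ 2 * dot v v * dot v v by rewrite /hexN; ring.
  have -> : hexB (r3 * dot v v) 0 (x k) (y k) = r3 ^+ 2 * dot v v * (2 * dot v (w k)).
    by rewrite /hexB /x /y; ring.
  by rewrite r3E.
have rv : 0 < r3 * dot v v by rewrite mulr_gt0.
have ci : leaf_close v (w i) by rewrite -vclose cone_close.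
have cj : leaf_close v (w j).
  rewrite -vclose /hex_close -(hexNm (r3 * dot v v)) -(hexNm (x j)).
  rewrite -(hexBm (r3 * dot v v)) oppr0 addr0; exact: cone_close.
apply/card_gt1P; exists i, j; split; rewrite ?inE ?iI ?jI //.
(* If both sectors caught the same leaf, it would have [y i = 0 < x i] and so lie on the ray of
   [v]. *)
apply: contraPneq (npar i iI) => E; rewrite -E in xj yj.
have yi0 : y i = 0 by lra.
have d0 : det (w i) = 0 by move: yi0; rewrite /y; lra.
have vw : 0 < dot v (w i) by move: xi; rewrite /x d0 subr0 pmulr_rgt0.
move/(_ (dot v (w i) / dot v v)); rewrite divr_gt0 // => /(_ isT); apply.
have nV : dot v v != 0 by rewrite lt0r_neq0.
(* Components of the identity [dot v v] w = [dot v w] v + [det w] v', where v' is [v] turned by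
   pi/2. *)
have e0 : dot v v * w i ord0 ord0 = dot v (w i) * v ord0 ord0.
  apply/eqP; rewrite -subr_eq0; apply/eqP.
  transitivity (- v ord0 ord_max * det (w i)); last by rewrite d0 mulr0.
  by rewrite /dot /det; ring.
have e1 : dot v v * w i ord0 ord_max = dot v (w i) * v ord0 ord_max.
  apply/eqP; rewrite -subr_eq0; apply/eqP.
  transitivity (v ord0 ord0 * det (w i)); last by rewrite d0 mulr0.
  by rewrite /dot /det; ring.
by apply: row2P; rewrite mxE; apply: (mulfI nV);
  rewrite ?e0 ?e1 mulrA (mulrCA _ (dot v (w i))) divff // mulr1.
Qed.

End Geometry.

(** * Drawings of stars and their bad pairs *)

Section StarDrawings.
Local Open Scope ring_scope.
Context {R : realType}.

Lemma dist_ltE (a b c d : 'rV[R]_2) :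
  (dist a b < dist c d) = (dot (a - b) (a - b) < dot (c - d) (c - d)).
Proof.
have distE u v : @dist R u v = Num.sqrt (dot (u - v) (u - v)).
  rewrite /dist /dot !big_ord_recl big_ord0 addr0 !mxE -!expr2.
  by rewrite (_ : lift ord0 ord0 = ord_max) //; apply/val_inj.
by rewrite !distE !ltNge ler_sqrt // dot_ge0.
Qed.

Lemma leaf_close_dist (c u v : 'rV[R]_2) :
  leaf_close (u - c) (v - c) = (dist u v < dist u c) || (dist u v < dist c v).
Proof.
rewrite !dist_ltE /leaf_close orbC; congr orb; rewrite -subr_gt0 -[RHS]subr_gt0;
  by congr (0 < _); rewrite /dot !mxE; ring.
Qed.

Lemma star_simple_path (s : nat) (i j : 'I_s) (p : seq (option 'I_s)) : i != j ->
  simple_path (star_graph s) (Some i) (Some j) p = (p == [:: None; Some j]).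
Proof.
move=> ij; apply/idP/eqP => [|->]; last first.
  by rewrite /simple_path /= !inE !andbT eqxx; apply: contra ij => /eqP[->].
case: p => [|[k|] [|[k'|] [|[l|] p]]]; rewrite /simple_path /= ?inE ?andbF ?eqxx ?orbT //=.
- by rewrite andbT => /eqP[E]; rewrite E eqxx in ij.
- by move=> /andP[/eqP->].
Qed.

(** Distinct non-adjacent vertices are two leaves, and their path consists of their two edges to the
    centre. *)
Lemma bad_pair_starE (s : nat) (D : option 'I_s -> 'rV[R]_2) (u v : option 'I_s) :
  bad_pair (T := star s) D u v <->
  exists i j, [/\ u = Some i, v = Some j, i != j &
                  leaf_close (D (Some i) - D None) (D (Some j) - D None)].
Proof.
split; last first.
  move=> [i [j [-> -> ij cl]]]; split => //; exists [:: None; Some j].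
  move: cl; rewrite leaf_close_dist => /orP[] cl.
    exists (Some i), None; split=> //; first by rewrite star_simple_path.
    by rewrite /= !eqxx.
  exists None, (Some j); split=> //; first by rewrite star_simple_path.
  by rewrite /= !eqxx ?orbT.
case=> uv nuv [p [w [z [pP wz lt]]]].
case: u v uv nuv pP wz lt => [i|] [j|] //= ij _ pP wz lt; exists i, j.
have {}ij : i != j by apply: contra ij => /eqP->.
split=> //; rewrite leaf_close_dist; move: pP; rewrite star_simple_path // => /eqP pE.
move: wz lt; rewrite {p}pE /= => /orP[|/orP[|]].
- by move=> /and3P[/eqP-> /eqP-> _] ->.
- by move=> /and3P[/eqP-> /eqP-> _] ->; rewrite orbT.
- by rewrite ?andbF.
Qed.

Lemma leaf_close_graph_irr (V : finType) (w : V -> 'rV[R]_2) :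
  irreflexive (fun i j => (i != j) && leaf_close (w i) (w j)).
Proof. by move=> i; rewrite eqxx. Qed.

Lemma leaf_close_graph_sym (V : finType) (w : V -> 'rV[R]_2) :
  symmetric (fun i j => (i != j) && leaf_close (w i) (w j)).
Proof. by move=> i j; rewrite eq_sym leaf_close_sym. Qed.

(** A nonzero vector is [leaf_close] to itself, hence the explicit [i != j]. *)
Definition leaf_close_graph (V : finType) (w : V -> 'rV[R]_2) : sgraph V :=
  SGraph (leaf_close_graph_sym V w) (leaf_close_graph_irr V w).

Lemma num_bad_pairs_star (s : nat) (D : option 'I_s -> 'rV[R]_2) :
  num_bad_pairs (T := star s) D =
  #|edges (leaf_close_graph 'I_s (fun i => D (Some i) - D None))|.
Proof.
have inj : injective (fun e : {set 'I_s} => Some @: e).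
  by apply: imset_inj; apply: Some_inj.
rewrite -(card_imset _ inj) /num_bad_pairs; apply/esym/eq_card => e.
rewrite [RHS]inE; apply/imsetP/asboolP.
  move=> [f]; rewrite inE => /existsP[i /existsP[j /andP[/andP[ij cl] /eqP->]]] ->.
  exists (Some i), (Some j); rewrite imsetU1 imset_set1; split => //.
  by apply/bad_pair_starE; exists i, j.
move=> [u [v [-> /bad_pair_starE[i [j [-> -> ij cl]]]]]].
exists [set i; j]; last by rewrite imsetU1 imset_set1.
by rewrite inE; apply/existsP; exists i; apply/existsP; exists j; rewrite /= ij cl eqxx.
Qed.

Lemma planar_star_neq0 (s : nat) (D : option 'I_s -> 'rV[R]_2) (i : 'I_s) :
  planar_drawing (star_graph s) D -> D (Some i) - D None != 0.
Proof. by move=> [inj _]; rewrite subr_eq0; apply/eqP => /inj. Qed.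

(** Edges leaving the centre in the same direction would overlap. *)
Lemma planar_star_parallel (s : nat) (D : option 'I_s -> 'rV[R]_2) (i j : 'I_s)
    (k : R) : planar_drawing (star_graph s) D -> i != j -> 0 < k ->
  D (Some i) - D None <> k *: (D (Some j) - D None).
Proof.
move=> [_ cross] ij k0 E.
have k1 : 0 < 1 + k by lra.
have ne : [set None; Some i] <> [set None; Some j].
  move/setP/(_ (Some i)); rewrite !inE eqxx orbT /= => /esym/eqP[E'].
  by rewrite E' eqxx in ij.
(* The parameters [t] and [t * k] of the common point add up to 1, so both lie strictly between 0
   and 1. *)
pose t := (1 + k)^-1.
have t01 : 0 < t < 1 by rewrite invr_gt0 k1 /= invf_lt1 //; lra.
have tk : 1 - t = t * k by rewrite /t; field; rewrite lt0r_neq0.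
apply: (cross None (Some i) None (Some j) _ _ ne
  (D None + t *: (D (Some i) - D None))) => //; split.
  exists t; split => //.
  by rewrite scalerBr scalerBl scale1r addrA addrAC.
exists (t * k); split; first by apply/andP; split; lra.
by rewrite E scalerA scalerBr scalerBl scale1r addrA addrAC.
Qed.

(** With the centre at 0, edges on different rays meet only at 0, which is interior to neither. *)
Lemma planar_star (s : nat) (f : 'I_s -> 'rV[R]_2) :
  (forall i, f i != 0) ->
  (forall i j k, i != j -> 0 < k -> f i <> k *: f j) ->
  planar_drawing (star_graph s) (fun u => if u is Some i then f i else 0).
Proof.
move=> f0 par; split.
  move=> [i|] [j|] //= E; last 2 first.
  - by have := f0 i; rewrite E eqxx.
  - by have := f0 j; rewrite -E eqxx.
  case: (eqVneq i j) => [->//|ij].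
  by case: (par i j 1 ij ltr01); rewrite scale1r.
(* [b = 0] occurs when the point of the closed segment is the centre. *)
have key (i j : 'I_s) (a b : R) : i != j -> 0 < a -> 0 <= b -> a *: f i <> b *: f j.
  move=> ij a0; rewrite le_eqVlt => /orP[/eqP<-|b0].
    by rewrite scale0r => /eqP; rewrite scaler_eq0 (negbTE (f0 i)) gt_eqF.
  move=> /(congr1 (fun x => a^-1 *: x)); rewrite !scalerA mulVf ?lt0r_neq0 //.
  by rewrite scale1r; apply: par; rewrite ?mulr_gt0 ?invr_gt0.
move=> u v w z uv wz ne p [[t [/andP[t0 t1] pE]] [t' [/andP[t0' t1'] pE']]].
move: pE; rewrite {}pE'.
have {}t1 : 0 < 1 - t by rewrite subr_gt0.
have {}t1' : 0 <= 1 - t' by rewrite subr_ge0.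
case: u uv ne => [i|]; case: v => [j|] //; case: w wz => [k|];
  case: z => [l|] //= _ _ ne; rewrite !scaler0 ?addr0 ?add0r => /esym; apply: key => //;
  by apply: contra_not_neq ne => -> //; rewrite finset.setUC.
Qed.

(** [leaf_close_two] supplies the hypothesis of [turan_lower_hexagon] for the graph of bad pairs of
    leaves. *)
Lemma star_bad_lower (s : nat) (D : option 'I_s -> 'rV[R]_2) :
  planar_drawing (star_graph s) D ->
  (turan_co 5 s <= num_bad_pairs (T := star s) D + (s == 6))%N.
Proof.
move=> plan; rewrite num_bad_pairs_star; set w := fun i => _; set G := leaf_close_graph _ _.
have := @turan_lower_hexagon _ G finset.setT; rewrite induced_edges_setT cardsT card_ord.
apply=> I v cI /stableP I0 vI.
have -> : [set i in I | G v i] = [set i in I | leaf_close (w v) (w i)].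
  apply/setP => i; rewrite !inE /=; case: (boolP (i \in I)) => //= iI.
  by have [E|] := eqVneq v i; first by rewrite E iI in vI.
apply: leaf_close_two => //.
- exact: planar_star_neq0.
- by move=> i _; apply: planar_star_neq0.
- by move=> i j iI jI ij; have := I0 i j iI jI; rewrite /= ij.
- move=> i iI k; apply: planar_star_parallel => //.
  by apply: contraNneq vI => <-.
Qed.

(** [G] lists the pairs that are allowed to be bad. Distinct directions are assumed only for these;
    far pairs have them by [leaf_close_parallel]. *)
Lemma star_bad_upper (s : nat) (G : sgraph 'I_s) (f : 'I_s -> 'rV[R]_2) :
  (forall i, f i != 0) ->
  (forall i j k, G i j -> 0 < k -> f i <> k *: f j) ->
  (forall i j, i != j -> ~~ G i j -> ~~ leaf_close (f i) (f j)) ->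
  exists D : option 'I_s -> 'rV[R]_2, planar_drawing (star_graph s) D /\
    (num_bad_pairs (T := star s) D <= #|edges G|)%N.
Proof.
move=> f0 par far; exists (fun u => if u is Some i then f i else 0); split.
  apply: planar_star => // i j k ij k0; have [Gij|Gij] := boolP (G i j).
    exact: par.
  by move=> E; have := far i j ij Gij; rewrite (leaf_close_parallel _ _ k).
rewrite num_bad_pairs_star subset_leq_card //; apply/fintype.subsetP => e.
rewrite !inE => /existsP[i /existsP[j /andP[/andP[ij cl] /eqP->]]].
apply/existsP; exists i; apply/existsP; exists j; rewrite eqxx andbT.
by apply: contraTT cl => Gij; rewrite !subr0 far.
Qed.

Lemma bp_star_le (s : nat) (G : sgraph 'I_s) (f : 'I_s -> 'rV[R]_2) :
  (forall i, f i != 0) ->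
  (forall i j k, G i j -> 0 < k -> f i <> k *: f j) ->
  (forall i j, i != j -> ~~ G i j -> ~~ leaf_close (f i) (f j)) ->
  (bp R (star s) <= #|edges G|)%N.
Proof.
move=> f0 par far; have [D [plan le]] := star_bad_upper s G f f0 par far.
apply: leq_trans le; have [|_] := @nat_minP [set k | exists D : tvert (star s) -> 'rV[R]_2,
    planar_drawing (star s) D /\ k = num_bad_pairs D]%classic.
  by exists (num_bad_pairs (T := star s) D), D.
by apply; exists D.
Qed.

Lemma bp_star_ge (s : nat) : (turan_co 5 s <= bp R (star s) + (s == 6))%N.
Proof.
rewrite /bp; have [|[D [plan ->]] _] := @nat_minP [set k | exists D : tvert (star s) -> 'rV[R]_2,
    planar_drawing (star s) D /\ k = num_bad_pairs D]%classic.
  by have [D plan] := star_drawable R s; exists (num_bad_pairs D), D.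
exact: star_bad_lower.
Qed.

End StarDrawings.

(** * Upper bounds from polygons, and the asymptotics *)

Section Polygons.
Local Open Scope classical_set_scope.
Local Open Scope ring_scope.
Context {R : realType}.

Definition row2 (x y : R) : 'rV[R]_2 := \row_j (if j == ord0 then x else y).

Lemma row2E (x y : R) : (row2 x y ord0 ord0 = x) * (row2 x y ord0 ord_max = y).
Proof. by rewrite !mxE. Qed.

(** A regular hexagon of circumradius 2; its sides also have length 2, which the strict inequalities
    in [leaf_close] tolerate. *)
Definition hexagon (k : nat) : 'rV[R]_2 :=
  let h := Num.sqrt 3 in
  row2 (nth 0 [:: 2; 1; - 1; - 2; - 1; 1] k) (nth 0 [:: 0; h; h; 0; - h; - h] k).

Lemma hexagon_far (k l : nat) : (k < 6)%N -> (l < 6)%N -> k != l ->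
  ~~ leaf_close (hexagon k) (hexagon l).
Proof.
rewrite /leaf_close /dot /hexagon !row2E.
have := @sqr_sqrtr R 3 ltac:(lra); move: (Num.sqrt 3) => h h3.
case: k => [|[|[|[|[|[|//]]]]]] _; case: l => [|[|[|[|[|[|//]]]]]] _ //= _;
  rewrite negb_or -!leNgt; lra.
Qed.

Lemma hexagon_neq0 (k : nat) : (k < 6)%N -> hexagon k != 0.
Proof.
move=> k6; apply/eqP => /(congr1 (fun M : 'rV_2 => M ord0 ord0)).
rewrite /hexagon row2E mxE.
by case: k k6 => [|[|[|[|[|[|//]]]]]] _ /= E; lra.
Qed.

Lemma bp_star_small (s : nat) : (s <= 6)%N -> bp R (star s) = 0%N.
Proof.
move=> s6; apply/eqP; rewrite -leqn0.
have lt6 (i : 'I_s) : (i < 6)%N by apply: leq_trans s6.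
(* The leaves have distinct residues mod 6, so [mod_graph 6 s] has no edges and all pairs are to be
   good. *)
have <- : turan_co 6 s = 0%N.
  by rewrite /turan_co big1 // => j _; rewrite divn_small.
apply: leq_trans (card_edges_mod_graph 6 s isT).
apply: (bp_star_le s _ (fun i : 'I_s => hexagon i)) => [i|i j k|i j ij _].
- exact: hexagon_neq0.
- by rewrite /= /mod_adj !modn_small // => /andP[/negP].
- exact: hexagon_far.
Qed.

(* An approximate regular pentagon with integer vertices, each vertex moved by [d]
   in the orthogonal direction. *)
Definition pentagon (k : nat) (d : R) : 'rV[R]_2 :=
  let x := nth 0 [:: 10; 3; - 8; - 8; 3] k in
  let y := nth 0 [:: 0; 10; 6; - 6; - 10] k in
  row2 (x - d * y) (y + d * x).

(** Neighbouring vertices are seen from the origin at angles above 69 degrees, their lengths are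
    nearly equal, and a shift of at most 1/100 turns each by less than one degree. *)
Lemma pentagon_far (k l : nat) (d e : R) : (k < 5)%N -> (l < 5)%N -> k != l ->
  0 <= d <= 100^-1 -> 0 <= e <= 100^-1 ->
  ~~ leaf_close (pentagon k d) (pentagon l e).
Proof.
move=> k5 l5 kl /andP[d0 d1] /andP[e0 e1].
(* With these bounds on the products the goals become linear. *)
have dd : 0 <= d * d by rewrite mulr_ge0.
have ee : 0 <= e * e by rewrite mulr_ge0.
have de : 0 <= d * e by rewrite mulr_ge0.
have de1 : d * e <= 100^-1 * 100^-1 by rewrite ler_pM.
rewrite /leaf_close /dot /pentagon !row2E; move: kl.
case: k k5 => [|[|[|[|[|//]]]]] _; case: l l5 => [|[|[|[|[|//]]]]] _ //= _;
  rewrite negb_or -!leNgt; lra.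
Qed.

Lemma pentagon_neq0 (k : nat) (d : R) : (k < 5)%N -> 0 <= d <= 100^-1 ->
  pentagon k d != 0.
Proof.
move=> k5 /andP[d0 d1]; apply/eqP => E.
have := congr1 (fun M : 'rV_2 => M ord0 ord0) E.
rewrite /pentagon row2E mxE.
by case: k k5 {E} => [|[|[|[|[|//]]]]] _ /= E; lra.
Qed.

(** A shift keeps the component along the unshifted vertex, which forces [c = 1]. *)
Lemma pentagon_parallel (k : nat) (d e c : R) : (k < 5)%N ->
  pentagon k d = c *: pentagon k e -> d = e.
Proof.
move=> k5 E.
have := congr1 (fun M : 'rV_2 => M ord0 ord0) E.
have := congr1 (fun M : 'rV_2 => M ord0 ord_max) E.
rewrite /pentagon !row2E !mxE /=.
case: k k5 {E} => [|[|[|[|[|//]]]]] _ /= E1 E2.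
all: have c1 : c = 1 by lra.
all: move: E1 E2; rewrite c1; lra.
Qed.

Lemma bp_star_le_turan (s : nat) : (bp R (star s) <= turan_co 5 s)%N.
Proof.
case: s => [|s]; first by rewrite bp_star_small.
apply: leq_trans (card_edges_mod_graph 5 s.+1 isT).
(* Distinct shifts below 1/100, so that the leaves of one cluster have distinct directions. *)
pose d (i : 'I_s.+1) : R := i%:R / s.+1%:R / 100.
have s0 : (0 : R) < s.+1%:R by rewrite ltr0n.
have d01 i : 0 <= d i <= 100^-1.
  rewrite !divr_ge0 //= ler_pdivrMr ?mulVf ?ltr0n ?pnatr_eq0 //.
  by rewrite ler_pdivrMr // mul1r ler_nat ltnW.
have lt5 (i : 'I_s.+1) : (i %% 5 < 5)%N by rewrite ltn_pmod.
apply: (bp_star_le s.+1 _ (fun i => pentagon (i %% 5) (d i))) => [i|i j k|i j ij].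
- exact: pentagon_neq0.
- rewrite /= /mod_adj => /andP[ij /eqP ->] _ /pentagon_parallel => /(_ (lt5 j)).
  move/divIf/divIf => /(_ (lt0r_neq0 s0)); rewrite pnatr_eq0 => /(_ isT)/eqP.
  by rewrite eqr_nat; apply/negP.
- by rewrite /= /mod_adj ij /= => ne; apply: pentagon_far.
Qed.

Lemma bp_starE (s : nat) :
  bp R (star s) = if (s <= 6)%N then 0%N else turan_co 5 s.
Proof.
case: leqP => s6; first exact: bp_star_small.
apply/eqP; rewrite eqn_leq bp_star_le_turan /=.
by have := bp_star_ge (R := R) s; rewrite gtn_eqF // addn0.
Qed.

(** For s = 5q + r the difference of [s * s] and [10 * turan_co 5 s] is 25q + r^2, with r at most
    4. *)
Lemma turan_co5_bounds (s : nat) :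
  (10 * turan_co 5 s <= s * s <= 10 * turan_co 5 s + 10 * s)%N.
Proof.
rewrite turan_co5E; have := ltn_pmod s (isT : (0 < 5)%N); have := divn_eq s 5.
move: (s %% 5)%N (s %/ 5)%N => r q -> r5.
have b2 : (2 * 'C(q, 2) + q = q * q)%N.
  by elim: q => // q; rewrite binS bin1; lia.
have -> : ((q * 5 + r) * (q * 5 + r) = 25 * (q * q) + 10 * (q * r) + r * r)%N by ring.
have rr : (r * r <= r * 4)%N by rewrite leq_mul2l; lia.
rewrite -b2; lia.
Qed.

Lemma turan_co5_bigO :
  (fun s : nat => (turan_co 5 s)%:R : R) =
  (fun s : nat => 10^-1 * s%:R ^+ 2 : R) +O_\oo (fun s : nat => s%:R : R).
Proof.
(* By [turan_co5_bounds] the error lies between -s and 0, so every constant above 1 works. *)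
apply/eqaddOP; exists 1; split; first exact: real1.
move=> c c1; exists 0%N => // s _ /=.
apply: (@le_trans _ _ `|s%:R : R|); last by rewrite ler_peMl // ltW.
rewrite -[X in `|X| <= _]/((turan_co 5 s)%:R - 10^-1 * s%:R ^+ 2).
rewrite (ger0_norm (ler0n _ _)) ler_norml expr2.
have /andP[] := turan_co5_bounds s.
rewrite -(ler_nat R) -(ler_nat R (s * s)) natrD !natrM => h1 h2.
by apply/andP; split; lra.
Qed.

End Polygons.

Local Open Scope classical_set_scope.
Local Open Scope ring_scope.

Theorem theorem28 (R : realType) :
  (forall s : nat,
     bp R (star s) = (if (s <= 6)%N then 0%N else tprime s 5)) /\
  (forall s : nat,
     tprime s 5 = (5 * 'C(s %/ 5, 2) + (s %/ 5) * (s %% 5))%N) /\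
  ((fun s : nat => (tprime s 5)%:R : R) =
     (fun s : nat => 10^-1 * s%:R ^+ 2 : R) +O_\oo (fun s : nat => s%:R : R)).
Proof.
have tE n : tprime n 5 = turan_co 5 n by exact: tprimeE.
split; [|split] => [s|s|].
- by rewrite bp_starE tE.
- by rewrite tE turan_co5E.
- by under eq_fun do rewrite tE; exact: turan_co5_bigO.
Qed.
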